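(* Let $p\ge 3$ be an odd prime and let $G$ be a metabelian $p$-group of maximal class of order $|G|=p^n$ and class $\mathrm{cl}(G)=m-1$, where $n=m\ge 3$. Suppose that generators $x,y$ of $G$ are selected such that $x\in G\setminus\chi_2(G)$ if $m\ge 4$, $y\in\chi_2(G)\setminus\gamma_2(G)$, and the relations $$x^p=s_{m-1}^w,\qquad y^p\prod_{\ell=2}^p s_\ell^{\binom{p}{\ell}}=s_{m-1}^z$$ are satisfied with exponents $0\le w,z\le p-1$. In the case of $m=3$ and the extra special $p$-group $G\simeq G_0^{(3)}(0,1)$ of exponent $p^2$, let $y$ be of order $p$. Let the maximal normal subgroups $M_1,\ldots,M_{p+1}$ of $G$ be ordered by $M_1=\langle y,\gamma_2(G)\rangle$ and $M_i=\langle xy^{i-2},\gamma_2(G)\rangle$ for $2\le i\le p+1$. Then, in particular, $M_1=\chi_2(G)$ if $m\ge 4$, and the following statements hold. (1) The kernels of the transfers $\mathrm{V}_i:G/\gamma_2(G)\to M_i/\gamma_2(M_i)$ for $1\le i\le p+1$ are given by $$\mathrm{Ker}(\mathrm{V}_1)=\begin{cases}G/\gamma_2(G),&\text{if }[\chi_2(G),\gamma_2(G)]=1,\ k=0,\ m\ge 3,\ w=0,\ z=0,\\ M_1/\gamma_2(G),&\text{if }[\chi_2(G),\gamma_2(G)]=1,\ k=0,\ m\ge 3,\ w=1,\ z=0,\\ M_2/\gamma_2(G),&\text{if }[\chi_2(G),\gamma_2(G)]=1,\ k=0,\ m\ge 4,\ w=0,\ z>0,\\ G/\gamma_2(G),&\text{if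 }[\chi_2(G),\gamma_2(G)]=\gamma_{m-1}(G),\ k=1,\ m\ge 5,\ p\ge 3,\\ G/\gamma_2(G),&\text{if }[\chi_2(G),\gamma_2(G)]=\gamma_{m-k}(G),\ k\ge 2,\ m\ge 6,\ p\ge 5,\end{cases}$$ and, for $2\le i\le p+1$, $$\mathrm{Ker}(\mathrm{V}_i)=\begin{cases}M_1/\gamma_2(G),&\text{if }m=3,\ w=1,\ z=0,\\ G/\gamma_2(G),&\text{if }m=3,\ w=0,\ z=0,\\ G/\gamma_2(G),&\text{if }m\ge 4.\end{cases}$$ (2) The singulets $\varkappa(i)$ of transfer types of $G$ with $1\le i\le p+1$ are given by $$\varkappa(1)=\begin{cases}0,&\text{if }m\ge 3,\ G\simeq G_0^{(m)}(0,0),\\ 1,&\text{if }m\ge 3,\ G=G_0^{(m)}(0,1),\\ 2,&\text{if }m\ge 4,\ G=G_0^{(m)}(z,0),\ z>0,\\ 0,&\text{if }[\chi_2(G),\gamma_2(G)]>1,\ k\ge 1,\ m\ge 5,\end{cases}$$ and, for $2\le i\le p+1$, $$\varkappa(i)=\begin{cases}1,&\text{if }m=3,\ G=G_0^{(3)}(0,1),\\ 0,&\text{if }m=3,\ G\simeq G_0^{(3)}(0,0),\\ 0,&\text{if }m\ge 4.\end{cases}$$ (3) The multiplet $\varkappa=(\varkappa(1),\ldots,\varkappa(p+1))$ of transfer types of $G$ is given by $$\varkappa=\begin{cases}(1,\ldots,1)\ (p+1\text{ ones}),\ \nu=0,&\text{if }m=3,\ G=G_0^{(3)}(0,1),\\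 (0,\ldots,0)\ (p+1\text{ zeros}),\ \nu=p+1,&\text{if }m\ge 3,\ G\simeq G_0^{(m)}(0,0),\\ (1,0,\ldots,0)\ (p\text{ zeros}),\ \nu=p,&\text{if }m\ge 4,\ G=G_0^{(m)}(0,1),\\ (2,0,\ldots,0)\ (p\text{ zeros}),\ \nu=p,&\text{if }m\ge 4,\ G=G_0^{(m)}(z,0),\ z>0,\\ (0,\ldots,0)\ (p+1\text{ zeros}),\ \nu=p+1,&\text{if }[\chi_2(G),\gamma_2(G)]>1,\ k\ge 1,\ m\ge 5.\end{cases}$$
   Context: Conventions: $[a,b]=a^{-1}b^{-1}ab$. The lower central series is $\gamma_1(G)=G$, $\gamma_j(G)=[\gamma_{j-1}(G),G]$ for $j\ge 2$. A $p$-group of order $p^m$ is of maximal class if its nilpotency class is $m-1$; then $G/\gamma_2(G)$ is of type $(p,p)$. Metabelian means that $\gamma_2(G)$ is abelian. $\chi_2(G)=\{g\in G\mid [g,u]\in\gamma_4(G)\text{ for all }u\in\gamma_2(G)\}$; it contains $\gamma_2(G)$ and equals $G$ if and only if $m=3$. The invariant $k=k(G)$ is defined by $[\chi_2(G),\gamma_2(G)]=\gamma_{m-k}(G)$, where $k=0$ for $m=3$, $0\le k\le m-4$ for $m\ge 4$, and $0\le k\le\min\{m-4,p-2\}$ for $m\ge p+1$. Commutators: $s_2=[y,x]$ and $s_j=[s_{j-1},x]$ for $j\ge 3$. $G_a^{(m)}(z,w)$ denotes the representative of an isomorphism class of metabelian $p$-groups of maximal class of order $p^m$ which satisfies the relation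 $[y,s_2]=\prod_{r=1}^k s_{m-r}^{a(m-r)}$ and the two $p$th power relations displayed in the claim with a fixed system of exponents $a=(a(m-k),\ldots,a(m-1))$, $w$ and $z$ (note the order of the arguments: first $z$, then $w$). The subscript $a=0$ in $G_0^{(m)}(z,w)$ corresponds to $k=0$, where $a$ is the empty family and $[y,s_2]=1$. $\mathrm{V}_i$ is the usual group theoretic transfer from $G$ to $M_i$. The singulet of transfer type is $\varkappa(i)=0$ if $\mathrm{Ker}(\mathrm{V}_i)=G/\gamma_2(G)$, and $\varkappa(i)=j$ if $\mathrm{Ker}(\mathrm{V}_i)=M_j/\gamma_2(G)$ with $1\le j\le p+1$. The number of total transfers is $\nu=\#\{1\le i\le p+1\mid\mathrm{Ker}(\mathrm{V}_i)=G/\gamma_2(G)\}$. *)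

(* Defs.v *)
From mathcomp Require Import all_boot all_fingroup finalg all_solvable.

Set Implicit Arguments.
Unset Strict Implicit.
Unset Printing Implicit Defensive.

Local Open Scope group_scope.

(* The commutator [~ a, b] is a^-1 * b^-1 * a * b, and gamma_j(G) is 'L_j(G). *)

Definition chi2 (gT : finGroupType) (G : {group gT}) : {set gT} :=
  [set g in G | [forall u in 'L_2(G), [~ g, u] \in 'L_4(G)]].

(* Only meant for j >= 2. *)
Definition scomm (gT : finGroupType) (x y : gT) (j : nat) : gT :=
  iter (j - 2) (fun s => [~ s, x]) [~ y, x].

(* Metabelian p-group of maximal class, of order p ^ m (used with 3 <= m). *)
Definition metabelian_maxclass (gT : finGroupType) (p m : nat)
    (G : {group gT}) : Prop :=
  [/\ #|G| = (p ^ m)%N, nil_class G = m.-1 & abelian 'L_2(G)].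

Definition selected_generators (gT : finGroupType) (m : nat) (G : {group gT})
    (x y : gT) : Prop :=
  [/\ <<[set x; y]>> = G, 4 <= m -> x \notin chi2 G
    & y \in chi2 G :\: 'L_2(G)].

Definition power_relations (gT : finGroupType) (p m z w : nat) (x y : gT) :
    Prop :=
  x ^+ p = scomm x y m.-1 ^+ w
  /\ y ^+ p * \prod_(2 <= l < p.+1) scomm x y l ^+ 'C(p, l)
     = scomm x y m.-1 ^+ z.

(* G = G_0^(m)(z,w), with respect to the generators x and y: for k = 0 the    *)
(* system of exponents a is empty and the relation for [y, s_2] is            *)
(* [y, s_2] = 1.                                                              *)
Definition is_G0 (gT : finGroupType) (p m z w : nat) (G : {group gT})
    (x y : gT) : Prop :=
  [/\ metabelian_maxclass p m G, selected_generators m G x y,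
      [~: chi2 G, 'L_2(G)] = 'L_m(G), [~ y, scomm x y 2] = 1
    & power_relations p m z w x y].

(* G is isomorphic to G_0^(m)(z,w), without reference to generators of G.     *)
Definition isog_G0 (gT : finGroupType) (p m z w : nat) (G : {group gT}) :
    Prop :=
  exists (hT : finGroupType) (H : {group hT}) (u v : hT),
    is_G0 p m z w H u v /\ G \isog H.

(* M_i; only meant for 1 <= i <= p + 1. *)
Definition maxsub (gT : finGroupType) (G : {group gT}) (x y : gT) (i : nat) :
    {group gT} :=
  if i == 1%N then <<y |: 'L_2(G)>>%G else <<(x * y ^+ (i - 2))%g |: 'L_2(G)>>%G.

Section AbelianizedTransfer.

Variables (gT : finGroupType) (G M : {group gT}).

Definition abelianization : {morphism M >-> coset_of 'L_2(M)} :=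
  restrm_morphism (lcn_norm 2 M) (coset_morphism 'L_2(M)).

Lemma abelianization_abelian : abelian (abelianization @* M).
Proof. by rewrite morphim_restrm setIid; exact: der_abelian 0 M. Qed.

Let V := transfer_morphism G abelianization_abelian.

Lemma ker_coset_sub_ker_transfer : 'ker (coset 'L_2(G)) \subset 'ker V.
Proof.
have sL2G : 'L_2(G) \subset G := lcn_sub 2 G.
rewrite ker_coset ker_trivg_morphim sL2G /= morphimR //.
by rewrite subG1; apply/eqP/commG1P; exact: FinRing.zmod_abelian.
Qed.

(* The transfer G / gamma_2(G) -> M / gamma_2(M), for M \subset G. The target *)
(* is M / gamma_2(M) written additively, through the library's fmod_of.       *)
Definition transfer_ab :=
  factm_morphism ker_coset_sub_ker_transfer (lcn_norm 2 G).

Definition ker_transfer : {set coset_of 'L_2(G)} := 'ker transfer_ab.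

End AbelianizedTransfer.

(* The singulet kappa(i): the least j <= p + 1 such that the kernel of V_i is *)
(* M_j / gamma_2(G), where M_0 stands for G; p + 2 if there is no such j.     *)
Definition kappa (gT : finGroupType) (p : nat) (G : {group gT}) (x y : gT)
    (i : nat) : nat :=
  find (fun j => ker_transfer G (maxsub G x y i)
                 == (if j == 0%N then G else maxsub G x y j) / 'L_2(G))
    (iota 0 p.+2).

Definition multiplet (gT : finGroupType) (p : nat) (G : {group gT}) (x y : gT) :
    seq nat :=
  [seq kappa p G x y i | i <- iota 1 p.+1].

Definition nb_total_transfers (gT : finGroupType) (p : nat) (G : {group gT})
    (x y : gT) : nat :=
  count (fun i => ker_transfer G (maxsub G x y i) == G / 'L_2(G))
    (iota 1 p.+1).

(* Main.v *)
(* Let M = <a, gamma_2(G)> be a maximal subgroup and G = <a, b>. Modulo M', the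
   transfer to M sends g outside M to g^p, and sends g in M to the product of
   its conjugates by 1, t, ..., t^(p-1), for any t outside M; writing the action
   of t on M / M' as 1 + D, this product is the sum of C(p, l + 1) D^l g.
   For M_1, with g = y and t = x, this is the left-hand side of the second power
   relation, so x and y are sent to s_{m-1}^w and s_{m-1}^z modulo
   M_1' = [chi_2(G), gamma_2(G)], which is trivial for k = 0 and contains
   s_{m-1} for k > 0. For M_i with i >= 2, M_i' = gamma_3(G) contains all the correction
   terms, so the transfer is the p-th power map modulo gamma_3(G), which
   contains x^p and y^p if m >= 4.
   If G is only isomorphic to G_0^(m)(0,0), the given x and y need not be the
   distinguished generators of that group, but all elements outside chi_2(G)
   (all elements, if m = 3) have p-th power 1. This property is invariant under
   isomorphism, and it suffices to evaluate the transfer to M_1 at x and xy, and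
   the other ones at y and xy^(i-2). *)

Require Import Defs.
From mathcomp Require Import all_boot all_fingroup ssralg all_solvable.

Set Implicit Arguments.
Unset Strict Implicit.
Unset Printing Implicit Defensive.

Local Open Scope group_scope.

Import FiniteModule.

(** * Transfer to a normal subgroup of prime index *)

(** Pascal's rule expresses [c l n] as the sum of C(n, j) D(l + j); applied again to the sum over i
    < n, it turns C(i, j) into C(n, j + 1). This is ((1 + D)^n - 1) / D without an operator ring. *)
Lemma sum_iter_binomial (U : zmodType) (D : nat -> U) (c : nat -> nat -> U) :
    (forall l, c l 0 = D l) ->
    (forall l i, c l i.+1 = c l i + c l.+1 i)%R ->
  forall n l, (\sum_(i < n) c l i = \sum_(j < n) D (l + j)%N *+ 'C(n, j.+1))%R.
Proof.
move=> c0 cS.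
have cE n l : (c l n = \sum_(j < n.+1) D (l + j)%N *+ 'C(n, j))%R.
  elim: n l => [|n IHn] l; first by rewrite big_ord1 c0 addn0 bin0.
  rewrite cS !IHn [in RHS]big_ord_recl bin0.
  under [in RHS]eq_bigr => j _ do rewrite /bump /= binS GRing.mulrnDr.
  rewrite big_split /= [X in (_ + (X + _))%R]big_ord_recr /= bin_small //.
  rewrite GRing.mulr0n GRing.addr0 GRing.addrA; congr (_ + _)%R.
    by rewrite [in LHS]big_ord_recl bin0.
  by apply: eq_bigr => j _; rewrite addnA addn1.
elim=> [|n IHn] l; first by rewrite !big_ord0.
rewrite big_ord_recr /= IHn cE.
under [in RHS]eq_bigr => j _ do rewrite binS GRing.mulrnDr.
rewrite big_split /= [X in (_ = X + _)%R]big_ord_recr /= bin_small //.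
by rewrite GRing.mulr0n GRing.addr0.
Qed.

Lemma prime_index_eq (gT : finGroupType) (G M K : {group gT}) :
    prime #|G : M| -> M \subset K -> K \subset G -> K :!=: G -> K :=: M.
Proof.
move=> pr_iM sMK sKG nKG; apply/eqP; rewrite eqEsubset sMK andbT.
have := Lagrange_index sKG sMK; rewrite -indexg_eq1 => defi.
have [_ div_iM] := primeP pr_iM.
have: #|G : K| %| #|G : M| by rewrite -defi dvdn_mulr.
case/div_iM/pred2P=> eqi; last first.
  by move/eqP: defi; rewrite eqi -{2}[#|G : M|]muln1 eqn_pmul2l ?prime_gt0.
by case/eqP: nKG; apply/eqP; rewrite eqEsubset sKG -indexg_eq1 eqi.
Qed.

Section Transfer.

Variables (gT : finGroupType) (G M : {group gT}) (p : nat).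
Hypotheses (nsMG : M <| G) (iMG : #|G : M| = p) (p_pr : prime p).

Let abM := abelianization_abelian M.
Let V := transfer_morphism G abM.

(** The class of [h] in M / M', in the additive form in which the transfer takes its values; used
    only for [h] in M. *)
Definition ab_class (h : gT) : fmod_of abM := fmod abM (coset 'L_2(M) h).

Let in_abM h : h \in M -> coset 'L_2(M) h \in abelianization M @* M.
Proof. by move=> Mh; rewrite morphim_restrm setIid mem_quotient. Qed.

Lemma ab_classM : {in M &, {morph ab_class : u v / u * v >-> (u + v)%R}}.
Proof.
move=> u v Mu Mv; rewrite /ab_class.
by rewrite morphM ?(subsetP (lcn_norm 2 M)) //= fmodM ?in_abM.
Qed.

Lemma ab_class_eq0 h : h \in M -> (ab_class h == 0%R) = (h \in 'L_2(M)).
Proof.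
move=> Mh; have nMh := subsetP (lcn_norm 2 M) h Mh.
apply/eqP/idP=> [f0 | L2h]; last by rewrite /ab_class coset_id ?fmod1.
apply: coset_idr => //; rewrite -(fmodK abM (in_abM Mh)).
by rewrite [fmod _ _]f0 fmval0.
Qed.

Lemma ab_class1 : ab_class 1 = 0%R.
Proof. by apply/eqP; rewrite ab_class_eq0. Qed.

Lemma ab_classX n : {in M, {morph ab_class : u / u ^+ n >-> (u *+ n)%R}}.
Proof.
move=> u Mu; elim: n => [|n IHn]; first by rewrite expg0 ab_class1.
by rewrite expgS ab_classM ?groupX // IHn GRing.mulrS.
Qed.

Lemma ab_class_prod I (r : seq I) (P : pred I) F : (forall i, F i \in M) ->
  ab_class (\prod_(i <- r | P i) F i) = (\sum_(i <- r | P i) ab_class (F i))%R.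
Proof.
move=> MF; elim: r => [|i r IHr]; first by rewrite !big_nil ab_class1.
by rewrite !big_cons; case: ifP => // _; rewrite ab_classM ?IHr ?group_prod.
Qed.

Lemma ab_classJ u h : h \in M -> u \in M -> ab_class (h ^ u) = ab_class h.
Proof.
move=> Mh Mu; rewrite conjg_mulR ab_classM ?groupR //.
rewrite [X in (_ + X)%R](_ : _ = 0%R) ?GRing.addr0 //.
by apply/eqP; rewrite ab_class_eq0; [apply: mem_commg | apply: groupR].
Qed.

(** The image of [t] in G / M is nontrivial, hence of order p, so the first p powers of [t]
    represent each coset exactly once. *)
Lemma rcosets_cycle t : t \in G :\: M ->
  rcosets M G = [set M :* t ^+ i | i : 'I_p]
  /\ {in setT &, injective (fun i : 'I_p => M :* t ^+ i)}.
Proof.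
case/setDP=> Gt M't; have [sMG nMG] := andP nsMG.
have nMt : t \in 'N(M) := subsetP nMG t Gt.
have nontr : coset M t != 1 by apply: contra M't => /eqP/coset_idr->.
have oGM : #|G / M| = p by rewrite card_quotient.
have ot : #[coset M t] = p.
  apply/prime_nt_dvdP=> //; first by rewrite order_eq1.
  by rewrite -oGM order_dvdG ?mem_quotient.
have inj : {in setT &, injective (fun i : 'I_p => M :* t ^+ i)}.
  move=> i j _ _ /= eqij; apply: val_inj; apply/eqP.
  have: coset M t ^+ i == coset M t ^+ j.
    rewrite -!morphX //; apply/eqP/val_inj; rewrite /= !val_coset ?groupX //.
  by rewrite eq_expg_mod_order ot !modn_small.
split=> //; apply/esym/eqP; rewrite eqEcard; apply/andP; split.
  by apply/subsetP=> _ /imsetP[i _ ->]; rewrite -rcosetE imset_f ?groupX.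
apply: eq_leq; transitivity p; first exact: iMG.
rewrite card_in_imset; first by rewrite card_ord.
by move=> i j _ _; apply: inj; rewrite inE.
Qed.

Lemma transfer_in g t : g \in M -> t \in G :\: M ->
  V g = (\sum_(i < p) ab_class (g ^ t ^+ i))%R.
Proof.
move=> Mg Gt; have [sMG nMG] := andP nsMG.
(* A representative r contributes r g r^-1, so powers of t^-1 are taken in order to get the
   conjugates [g ^ t ^+ i]. The chosen [repr] differs by a factor from M, which is invisible in M /
   M'. *)
have GtV : t^-1 \in G :\: M by rewrite inE !groupV -in_setD.
have [defX injX] := rcosets_cycle GtV.
rewrite /V /= /transfer defX big_imset /=; last first.
  by move=> i j _ _; apply: injX; rewrite inE.
apply: eq_bigr => i _.
have Gti : t^-1 ^+ i \in G by rewrite groupX //; case/setDP: GtV.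
have -> : M :* t^-1 ^+ i :* g = M :* t^-1 ^+ i.
  have nti : t^-1 ^+ i \in 'N(M) := subsetP nMG _ Gti.
  by rewrite (norm_rlcoset nti) -mulgA (rcoset_id Mg).
case: repr_rcosetP => h Mh.
rewrite -[LHS]/(ab_class _).
have -> : h * t^-1 ^+ i * g * (h * t^-1 ^+ i)^-1 = (g ^ t ^+ i) ^ h^-1.
  by rewrite !conjgE !invMg expgVn !invgK !mulgA.
rewrite ab_classJ ?groupV // memJ_norm //.
by apply: (subsetP nMG); rewrite -groupV -expgVn.
Qed.

(* Conjugation by [t] acts on [M / M'] as [1 + D], where [D] is [s |-> [s, t]];
   its first [p] powers add up to [((1 + D)^p - 1) / D]. *)
Lemma transfer_in_binomial g t : g \in M -> t \in G :\: M ->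
  V g = (\sum_(l < p) ab_class (iter l (fun s => [~ s, t]) g)
                        *+ 'C(p, l.+1))%R.
Proof.
move=> Mg GDt; have [sMG nMG] := andP nsMG.
have [Gt _] := setDP GDt; have nMt := subsetP nMG t Gt.
rewrite (transfer_in Mg GDt); set D := fun s => [~ s, t].
have MD l : iter l D g \in M.
  by elim: l => //= l IHl; rewrite /D commgEl groupM ?groupV ?memJ_norm.
(* [c l i] is (1 + D)^i D^l g; its recursion comes from h^t = h [h, t]. *)
pose c l i := ab_class (iter l D g ^ t ^+ i).
have c0 l : c l 0 = ab_class (iter l D g) by rewrite /c expg0 conjg1.
apply: (sum_iter_binomial c0 _ p 0) => l i.
rewrite /c -ab_classM ?memJ_norm ?groupX // -conjMg /= -conjg_mulR.
by rewrite expgS conjgM.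
Qed.

(** The cosets of M form a single orbit of length p under right multiplication by [g], so the cycle
    expansion of the transfer has g^p as its only term. *)
Lemma transfer_out g : g \in G :\: M -> V g = ab_class (g ^+ p).
Proof.
move=> GDg; have [sMG nMG] := andP nsMG; have [Gg M'g] := setDP GDg.
have [defX injX] := rcosets_cycle GDg.
have MgG x : x \in G -> M :* x * <[g]> = G.
  move=> Gx; apply/eqP; rewrite eqEsubset mul_subG ?cycle_subG //=; last first.
    by rewrite mul_subG ?sub1set.
  apply/subsetP=> u Gu; have: M :* (x^-1 * u) \in rcosets M G.
    by rewrite -rcosetE imset_f // groupM ?groupV.
  rewrite defX => /imsetP[i _ eqi].
  have /rcosetP[h Mh def_u]: x^-1 * u \in M :* g ^+ i.
    by rewrite -eqi rcoset_refl.
  apply/mulsgP; exists (h ^ x^-1 * x) (g ^+ i); last 1 first.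
  - by rewrite -(mulKVg x u) def_u conjgE invgK !mulgA mulgKV.
  - by rewrite mem_rcoset mulgK memJ_norm // (subsetP nMG) ?groupV.
  by rewrite mem_cycle.
have trX : is_transversal [set 1] (rcosets M G :* <[g]>) G.
  apply/and3P; split; first exact: rcosets_cycle_partition.
    by rewrite sub1set group1.
  apply/forall_inP=> A /mulsgP[_ _ /rcosetsP[x Gx ->] /set1P-> ->].
  by rewrite /= MgG // (setIidPl _) ?cards1 ?sub1set.
rewrite /V /= (transfer_cycle_expansion sMG abM Gg trX) big_set1.
have:= sum_index_rcosets_cycle sMG Gg trX; rewrite big_set1 iMG => ->.
by rewrite invg1 conjg1.
Qed.

Lemma lcn2_sub_ker : 'L_2(G) \subset 'ker V.
Proof. by have := ker_coset_sub_ker_transfer G M; rewrite ker_coset. Qed.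

Lemma ker_transferE : ker_transfer G M = 'ker V / 'L_2(G).
Proof. by rewrite /ker_transfer ker_factm. Qed.

Lemma ker_transfer_total a b :
    <<[set a; b]>> = G -> V a = 0%R -> V b = 0%R ->
  ker_transfer G M = G / 'L_2(G).
Proof.
move=> defG Va Vb; rewrite ker_transferE.
apply: (congr1 (fun A => A / 'L_2(G))); apply/eqP.
rewrite eqEsubset subsetIl -{1}defG gen_subG; apply/subsetP=> c abc.
have Gc : c \in G by rewrite -defG mem_gen.
by apply/kerP=> //; case/set2P: abc => ->.
Qed.

(** The kernel contains a subgroup of prime index and misses [g], so it equals that subgroup. *)
Lemma ker_transfer_maximal c g :
    prime #|G : <<c |: 'L_2(G)>> | -> c \in G -> g \in G ->
    V c = 0%R -> V g != 0%R ->
  ker_transfer G M = <<c |: 'L_2(G)>> / 'L_2(G).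
Proof.
move=> pr_i Gc Gg Vc Vg; rewrite ker_transferE.
apply: (congr1 (fun A => A / 'L_2(G))).
apply: (prime_index_eq pr_i).
- rewrite gen_subG subUset sub1set lcn2_sub_ker andbT; exact/kerP.
- exact: subsetIl.
by apply: contraNneq Vg => defK; have := Gg; rewrite -{1}defK => /(kerP V Gg)->.
Qed.

End Transfer.

(** * Commutators in metabelian groups *)

Section Commutators.

Variables (gT : finGroupType) (G : {group gT}).

(** Since [u, g h] = [u, h] [u, g]^h, the elements g of N(K) with [u, g] in K form a group. *)
Lemma commg_gen_mod (K : {group gT}) (A : {set gT}) u :
    A \subset 'N(K) -> (forall a, a \in A -> [~ u, a] \in K) ->
  forall g, g \in <<A>> -> [~ u, g] \in K.
Proof.
move=> nKA uA.
have gC: group_set [set g in 'N(K) | [~ u, g] \in K].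
  apply/group_setP; split=> [|g h /setIdP[Ng Kg] /setIdP[Nh Kh]].
    by apply/setIdP; rewrite commg1 !group1.
  by apply/setIdP; rewrite groupM // commgMJ groupM // memJ_norm.
suff sAC: <<A>> \subset Group gC by move=> g /(subsetP sAC)/setIdP[].
rewrite gen_subG; apply/subsetP=> a Aa.
by apply/setIdP; rewrite (subsetP nKA) ?uA.
Qed.

Lemma commg_memC (K : {group gT}) u v : ([~ u, v] \in K) = ([~ v, u] \in K).
Proof. by rewrite -invg_comm groupV. Qed.

Lemma chi2_group_set : group_set (chi2 G).
Proof.
apply/group_setP; split=> [|g h].
  by rewrite inE group1; apply/forall_inP=> u _; rewrite comm1g group1.
rewrite !inE => /andP[Gg /forall_inP gC] /andP[Gh /forall_inP hC].
rewrite groupM //; apply/forall_inP=> u L2u.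
by rewrite commMgJ groupM ?hC // memJ_norm ?gC // (subsetP (lcn_norm 4 G)).
Qed.
Canonical chi2_group := Group chi2_group_set.

Lemma chi2_sub : chi2 G \subset G.
Proof. by apply/subsetP=> g; rewrite inE => /andP[]. Qed.

Lemma comm_chi2_lcn2 : [~: chi2 G, 'L_2(G)] \subset 'L_4(G).
Proof.
rewrite gen_subG; apply/subsetP=> _ /imset2P[g u gC L2u ->].
by move: gC; rewrite inE => /andP[_ /forall_inP->].
Qed.

Hypothesis abL2 : abelian 'L_2(G).

Lemma lcn2_sub_chi2 : 'L_2(G) \subset chi2 G.
Proof.
apply/subsetP=> g L2g; rewrite inE (subsetP (lcn_sub 2 G)) //.
apply/forall_inP=> u L2u; have /commgP/eqP-> := centsP abL2 g L2g u L2u.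
exact: group1.
Qed.

(** Induction by the three subgroup lemma modulo gamma_{j+5}: [G, chi_2, gamma_{j+2}] is trivial
    because gamma_2 is abelian, and [chi_2, gamma_{j+2}, G] lies in [gamma_{j+4}, G] by
    induction. *)
Lemma comm_chi2_lcn j : [~: chi2 G, 'L_j.+2(G)] \subset 'L_j.+4(G).
Proof.
elim: j => [|j IHj]; first exact: comm_chi2_lcn2.
have nN := lcn_norm j.+4.+1 G; have sCG := chi2_sub.
have sL n : 'L_n(G) \subset G := lcn_sub n G.
set N := 'L_j.+4.+1(G) in nN *.
have qR (A B : {set gT}) : A \subset G -> B \subset G ->
    [~: A, B] / N = [~: A / N, B / N].
  by move=> sAG sBG; rewrite quotientR // (subset_trans _ nN).
have sRG (A B : {set gT}) : A \subset G -> B \subset G -> [~: A, B] \subset G.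
  exact: comm_subG.
rewrite commGC (lcnSn j.+1) -quotient_sub1; last first.
  by apply: subset_trans nN; apply: (sRG) => //; apply: sRG.
have sLG := sL j.+2; have sLGG := sRG _ _ sLG (subxx G).
rewrite (qR [~: 'L_j.+2(G), G]) // (qR 'L_j.+2(G)) //.
apply/trivgP; apply: three_subgroup.
  rewrite -(qR G (chi2 G)) // -qR //; last exact: sRG.
  rewrite (_ : [~: G, chi2 G, 'L_j.+2(G)] = 1) ?quotient1 //.
  apply/commG1P; apply: subset_trans (commgS G sCG) _.
  by apply: subset_trans abL2 _; apply/centS/lcn_sub_leq.
rewrite -(qR (chi2 G)) // -qR //; last exact: sRG.
apply/trivgP; rewrite quotient_sub1; last first.
  by apply: subset_trans nN; apply: (sRG) => //; apply: sRG.
exact: commSg.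
Qed.

Variables x y : gT.
Hypotheses (defG : <<[set x; y]>> = G) (Cy : y \in chi2 G).

Let Gx : x \in G. Proof. by rewrite -defG mem_gen ?set21. Qed.
Let Gy : y \in G. Proof. by rewrite -defG mem_gen ?set22. Qed.

Lemma scommS j : scomm x y j.+3 = [~ scomm x y j.+2, x].
Proof. by rewrite /scomm !subSS !subn0. Qed.

Lemma scomm_lcn j : scomm x y j.+2 \in 'L_j.+2(G).
Proof.
elim: j => [|j IHj]; first exact: mem_commg.
by rewrite scommS lcnSn mem_commg.
Qed.

Lemma scomm_lcn_norm j : G \subset 'N(<<scomm x y j.+2 |: 'L_j.+3(G)>>).
Proof.
rewrite -commg_subl; apply: subset_trans (joing_subr _ _).
by apply: commSg; rewrite gen_subG subUset sub1set scomm_lcn lcn_subS.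
Qed.

(** Commutation with y, which lies in chi_2, drops two steps down the series, so modulo the next
    term only commutation with x survives, and it takes each s_i to s_{i+1}. *)
Lemma lcn_scomm j : 'L_j.+2(G) \subset <<scomm x y j.+2 |: 'L_j.+3(G)>>.
Proof.
have nKA (K : {group gT}) : G \subset 'N(K) -> [set x; y] \subset 'N(K).
  by rewrite -{1}defG gen_subG.
elim: j => [|j IHj]; rewrite lcnSn gen_subG;
  apply/subsetP=> _ /imset2P[u g Lu Gg ->].
  set K := <<_>>%G; have nKG := nKA K (scomm_lcn_norm 0).
  have Ks : [~ y, x] \in K by rewrite mem_gen ?setU11.
  rewrite -defG in Gg; rewrite /= -defG in Lu.
  apply: (commg_gen_mod nKG) (Gg) => a /set2P[]->; rewrite commg_memC;
    apply: (commg_gen_mod nKG) (Lu) => b /set2P[]-> //;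
    by rewrite ?commgg ?group1 // commg_memC.
set K := <<_>>%G; have nKG := scomm_lcn_norm j.+1.
have sLK : 'L_j.+4(G) \subset K by apply: joing_subr.
have sSG : scomm x y j.+2 |: 'L_j.+3(G) \subset G.
  by rewrite subUset sub1set (subsetP (lcn_sub _ G) _ (scomm_lcn j)) lcn_sub.
rewrite commg_memC.
apply: (commg_gen_mod (subset_trans sSG nKG)) (subsetP IHj u Lu) => a.
rewrite commg_memC => /setU1P[-> | La]; last first.
  by apply: (subsetP sLK); rewrite lcnSn mem_commg.
rewrite -defG in Gg; apply: (commg_gen_mod (nKA _ nKG)) (Gg) => b /set2P[]->.
  by rewrite -scommS mem_gen ?setU11.
apply: (subsetP sLK); apply: (subsetP (comm_chi2_lcn j)).
by rewrite commGC mem_commg ?scomm_lcn.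
Qed.

End Commutators.

(** * Maximal subgroups *)

Section MaximalSubgroup.

Variables (gT : finGroupType) (G : {group gT}) (p : nat) (a b : gT).
Hypotheses (p_pr : prime p) (nilG : nilpotent G) (nabG : ~~ abelian G).
Hypotheses (defG : <<[set a; b]>> = G) (L2bp : b ^+ p \in 'L_2(G)).

Let M := <<a |: 'L_2(G)>>%G.

Let Ga : a \in G. Proof. by rewrite -defG mem_gen ?set21. Qed.
Let Gb : b \in G. Proof. by rewrite -defG mem_gen ?set22. Qed.

Lemma gen_lcn2_normal : M <| G.
Proof.
apply: sub_der1_normal; first exact: joing_subr.
by rewrite gen_subG subUset sub1set Ga lcn_sub.
Qed.

(** Otherwise G / G' would be generated by the image of [a], and a nilpotent group with cyclic G /
    G' is abelian. *)
Lemma notin_gen_lcn2 : b \in G :\: M.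
Proof.
have [sMG nMG] := andP gen_lcn2_normal.
rewrite inE Gb andbT; apply: contra nabG => Mb.
have defM : M :=: G.
  apply/eqP; rewrite eqEsubset sMG -{1}defG gen_subG subUset !sub1set Mb andbT.
  by rewrite mem_gen ?setU11.
apply/cyclic_abelian; rewrite cyclic_nilpotent_quo_der1_cyclic //.
have nLa : a \in 'N('L_2(G)) := subsetP (lcn_norm 2 G) a Ga.
suff -> : G / G^`(1) = <[coset 'L_2(G) a]> by apply: cycle_cyclic.
rewrite -quotient_cycle // -(quotientMidr 'L_2(G) <[a]>).
apply: (congr1 (fun A => A / 'L_2(G))).
by rewrite -norm_joinEl ?cycle_subG // joing_idl.
Qed.

(** G / M is generated by the image of [b], which is nontrivial and has trivial p-th power because
    b^p lies in gamma_2(G). *)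
Lemma index_gen_lcn2 : #|G : M| = p.
Proof.
have [sMG nMG] := andP gen_lcn2_normal; have [_ M'b] := setDP notin_gen_lcn2.
have nMb := subsetP nMG b Gb.
rewrite -card_quotient //.
have -> : G / M = <[coset M b]>.
  rewrite -quotient_cycle // -(quotientMidl M <[b]>).
  apply: (congr1 (fun A => A / M)).
  rewrite -norm_joinEr ?cycle_subG //; apply/eqP.
  rewrite eqEsubset; apply/andP; split; last first.
    by rewrite join_subG sMG cycle_subG.
  rewrite -{1}defG gen_subG; apply/subsetP=> _ /set2P[]->.
    by apply: (subsetP (joing_subl _ _)); rewrite mem_gen ?setU11.
  by apply: (subsetP (joing_subr _ _)); apply: cycle_id.
apply/prime_nt_dvdP=> //.
  by rewrite order_eq1; apply: contra M'b => /eqP/coset_idr->.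
rewrite order_dvdn -morphX //; apply/eqP/coset_id.
by rewrite (subsetP (joing_subr _ _)).
Qed.

(** Modulo [M, gamma_2(G)], M is generated by [a] and a central subgroup, so it is abelian. *)
Lemma lcn2_gen_lcn2 : 'L_2(M) \subset [~: M, 'L_2(G)].
Proof.
have [sMG nMG] := andP gen_lcn2_normal.
have sLM : 'L_2(G) \subset M by apply: joing_subr.
pose K := [~: M, 'L_2(G)]%G; have nKM : a |: 'L_2(G) \subset 'N(K).
  by rewrite -gen_subG; apply: commg_norml.
have Ma : a \in M by rewrite mem_gen ?setU11.
rewrite gen_subG; apply/subsetP=> _ /imset2P[u v Mu Mv ->].
have nK := commg_gen_mod nKM.
apply: (nK) (Mv) => c /setU1P[-> | Lc]; last exact: mem_commg.
rewrite commg_memC; apply: (nK) (Mu) => d /setU1P[-> | Ld].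
  by rewrite commgg group1.
exact: mem_commg.
Qed.

(* Since [[L_2, b]] lies in [L_4], [L_3 = [L_2, <a, b>]] lies in [M' L_4];
   nilpotency of [G / M'] then forces [L_3] into [M']. *)
Lemma lcn3_gen_lcn2 : b \in chi2 G -> 'L_2(M) = 'L_3(G).
Proof.
move=> Cb; have [sMG nMG] := andP gen_lcn2_normal.
have sLM : 'L_2(G) \subset M by apply: joing_subr.
have Ma : a \in M by rewrite mem_gen ?setU11.
apply/eqP; rewrite eqEsubset (subset_trans lcn2_gen_lcn2) /=; last first.
  rewrite commGC; exact: commgS.
have nNG : G \subset 'N('L_2(M)) by apply: gFnorm_trans.
have sLG n : 'L_n(G) \subset G := lcn_sub n G.
have nNL n : 'L_n(G) \subset 'N('L_2(M)) := subset_trans (sLG n) nNG.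
set K := ('L_2(M) <*> 'L_4(G))%G.
have nKG : [set a; b] \subset 'N(K).
  by rewrite -gen_subG defG normsY ?lcn_norm.
have sL3K : 'L_3(G) \subset K.
  rewrite (lcnSn 1) gen_subG; apply/subsetP=> _ /imset2P[u g Lu Gg ->].
  rewrite -defG in Gg; apply: (commg_gen_mod nKG) (Gg) => c /set2P[]->.
    apply: (subsetP (joing_subl _ _)); apply: mem_commg => //.
    exact: (subsetP sLM).
  apply: (subsetP (joing_subr _ _)); rewrite commg_memC.
  by move: Cb; rewrite inE => /andP[_ /forall_inP->].
rewrite -quotient_sub1 // subG1; apply/idPn => ntL3.
have nLG : G / 'L_2(M) \subset 'N_(G / 'L_2(M))('L_3(G) / 'L_2(M)).
  by rewrite subsetI subxx quotient_norms ?lcn_norm.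
have nilGN := quotient_nil 'L_2(M) nilG.
have := nil_comm_properl nilGN (quotientS _ (sLG 3)) ntL3 nLG.
rewrite -quotientR ?nNL // => /proper_subn/negP[].
apply: subset_trans (quotientS _ sL3K) _.
by rewrite /K /= norm_joinEr ?nNL // quotientMidl.
Qed.

End MaximalSubgroup.

(** * Groups of maximal class *)

Section MaximalClass.

Variables (gT : finGroupType) (G : {group gT}) (x y : gT) (p n z w : nat).
Hypotheses (p_pr : prime p) (p_odd : odd p).
Hypothesis G_mc : metabelian_maxclass p n.+3 G.
Hypothesis xy_gen : selected_generators n.+3 G x y.
Hypothesis xy_rel : power_relations p n.+3 z w x y.

(** With m = n + 3 this is s_{m-1}; accordingly, m >= 4 becomes [0 < n]. *)
Let s := scomm x y n.+2.

Let defG : <<[set x; y]>> = G. Proof. by case: xy_gen. Qed.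
Let abL2 : abelian 'L_2(G). Proof. by case: G_mc. Qed.
Let Gx : x \in G. Proof. by rewrite -defG mem_gen ?set21. Qed.
Let Gy : y \in G. Proof. by rewrite -defG mem_gen ?set22. Qed.
Let Cy : y \in chi2 G. Proof. by case: xy_gen => _ _ /setDP[]. Qed.

Let pG : p.-group G.
Proof. by case: G_mc => oG _ _; rewrite /pgroup oG pnatX pnat_id. Qed.

Let nilG : nilpotent G. Proof. exact: pgroup_nil pG. Qed.

Let classG : nil_class G = n.+2. Proof. by case: G_mc. Qed.

Let nabG : ~~ abelian G. Proof. by rewrite -nil_class1 classG. Qed.

Let Lm1 : 'L_n.+3(G) = 1.
Proof. by apply/(lcn_nil_classP n.+2 nilG); rewrite classG. Qed.

(** If s_{m-1} were trivial, [lcn_scomm] would make gamma_{m-1}(G) trivial, against class m - 1. *)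
Lemma scomm_last_neq1 : s != 1.
Proof.
apply/eqP=> s1; have := lcn_scomm abL2 defG Cy n.
rewrite -/s s1 Lm1 setUid => sL1.
have: nil_class G <= n.+1.
  apply/(lcn_nil_classP n.+1 nilG)/trivgP; apply: subset_trans sL1 _.
  by rewrite gen_subG.
by rewrite classG ltnn.
Qed.

Lemma expg_scomm_last_eq1 e : e < p -> s ^+ e = 1 -> e = 0.
Proof.
move=> lt_ep se1; have Gs : s \in G.
  exact: subsetP (lcn_sub _ G) _ (scomm_lcn defG n).
have ps : p %| #[s].
  have /p_natP[j oj] := mem_p_elt pG Gs.
  case: j oj => [|j] oj; last by rewrite oj expnS dvdn_mulr.
  by move: scomm_last_neq1; rewrite -order_eq1 oj expn0.
have: p %| e by apply: dvdn_trans ps _; rewrite order_dvdn se1.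
case: e lt_ep {se1} => // e lt_ep /dvdn_leq.
by rewrite (leqNgt p) lt_ep => /(_ isT).
Qed.

Lemma scomm_lcn2 l : scomm x y l \in 'L_2(G).
Proof.
(* For l < 2 the truncated [l - 2] makes [scomm x y l] equal to s_2, so this holds for all l. *)
have -> : scomm x y l = scomm x y (l - 2).+2 by rewrite /scomm !subSS subn0.
exact: subsetP (lcn_sub_leq _ _) _ (scomm_lcn defG _).
Qed.

(** * The p-th powers modulo gamma_3(G) *)

Let mod_lcn3 g : g \in G -> (g \in 'L_3(G)) = (coset 'L_3(G) g == 1).
Proof.
move=> Gg; apply/idP/eqP=> [/coset_id // | /coset_idr]; apply.
exact: subsetP (lcn_norm 3 G) g Gg.
Qed.

Let nL3 g : g \in G -> g \in 'N('L_3(G)).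
Proof. exact: subsetP (lcn_norm 3 G) g. Qed.

Let comm_central u g : u \in 'L_2(G) -> g \in G ->
  commute (coset 'L_3(G) u) (coset 'L_3(G) g).
Proof.
move=> Lu Gg; have Gu := subsetP (lcn_sub 2 G) u Lu.
apply/commgP; rewrite -morphR ?nL3 //= -mod_lcn3; last exact: groupR.
exact: mem_commg.
Qed.

Let s_lcn : s \in 'L_n.+2(G). Proof. exact: scomm_lcn. Qed.

(** Modulo gamma_3 the power [y, x]^p equals [y, x^p], and this is trivial because x^p is a power of
    the central element s_{m-1}. *)
Lemma scomm2_exp_lcn3 : [~ y, x] ^+ p \in 'L_3(G).
Proof.
have Lyx : [~ y, x] \in 'L_2(G) by apply: mem_commg.
rewrite mod_lcn3 ?groupX ?groupR // morphX ?nL3 ?groupR //= morphR ?nL3 //.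
rewrite -commgX; last first.
  by rewrite /commute -morphR ?nL3 //; apply/esym/comm_central.
rewrite -morphX ?nL3 // -morphR ?nL3 ?groupX //= -mod_lcn3;
  last by rewrite groupR ?groupX.
have: [~ x ^+ p, y] \in 'L_n.+3(G).
  by apply: mem_commg => //; case: xy_rel => -> _; rewrite groupX.
by rewrite Lm1 => /set1P cxy; rewrite -invg_comm cxy invg1 group1.
Qed.

(** As gamma_2 is abelian, the p-th power map is multiplicative on it, and it suffices to look at
    s_2 and gamma_3. *)
Lemma lcn2_exp_lcn3 : {in 'L_2(G), forall u, u ^+ p \in 'L_3(G)}.
Proof.
have gE : group_set [set u in 'L_2(G) | u ^+ p \in 'L_3(G)].
  apply/group_setP; split=> [|u v /setIdP[Lu Eu] /setIdP[Lv Ev]].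
    by apply/setIdP; rewrite expg1n !group1.
  apply/setIdP; rewrite groupM //; split=> //.
  by rewrite expgMn ?groupM //; apply: (centsP abL2).
suff sLE: 'L_2(G) \subset Group gE by move=> u /(subsetP sLE)/setIdP[].
apply: subset_trans (lcn_scomm abL2 defG Cy 0) _.
rewrite gen_subG; apply/subsetP=> v /setU1P[-> | Lv]; apply/setIdP.
  by rewrite scomm_lcn // scomm2_exp_lcn3.
by rewrite groupX // (subsetP (lcn_subS 2 G)).
Qed.

(** Oddness of p enters here, as 2 < p. *)
Let p_dvd_bin2 : p %| 'C(p, 2).
Proof.
apply: prime_dvd_bin => //; have := prime_gt1 p_pr.
by case: p p_odd => [|[|[|q]]].
Qed.

Lemma lcn2_exp_bin2 u : u \in 'L_2(G) -> u ^+ 'C(p, 2) \in 'L_3(G).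
Proof.
move=> Lu; case/dvdnP: p_dvd_bin2 => q ->.
by rewrite mulnC expgM groupX // lcn2_exp_lcn3.
Qed.

(** G / gamma_3 has class at most 2, so there (a b)^p = a^p b^p [b, a]^C(p, 2), and the last two
    factors vanish. *)
Lemma expgM_lcn3 a b : a \in G -> b \in G -> b ^+ p \in 'L_3(G) ->
  ((a * b) ^+ p \in 'L_3(G)) = (a ^+ p \in 'L_3(G)).
Proof.
move=> Ga Gb bp; have Lba : [~ b, a] \in 'L_2(G) by apply: mem_commg.
rewrite !mod_lcn3 ?groupX ?groupM // morphX ?nL3 ?groupM // morphM ?nL3 //=.
rewrite expMg_Rmul; first last.
- by rewrite /commute -morphR ?nL3 //; apply/esym/comm_central.
- by rewrite /commute -morphR ?nL3 //; apply/esym/comm_central.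
rewrite -morphR ?nL3 // -!morphX ?nL3 ?groupR //=.
by rewrite !(coset_id bp) (coset_id (lcn2_exp_bin2 Lba)) !mulg1.
Qed.

Lemma x_exp_lcn2 : x ^+ p \in 'L_2(G).
Proof. by case: xy_rel => -> _; rewrite groupX ?scomm_lcn2. Qed.

Lemma y_exp_lcn2 : y ^+ p \in 'L_2(G).
Proof.
case: xy_rel => _ eqy; have := groupX z (scomm_lcn2 n.+2); rewrite -eqy.
by rewrite groupMr // group_prod // => l _; rewrite groupX ?scomm_lcn2.
Qed.

Lemma x_exp_lcn3 : 0 < n -> x ^+ p \in 'L_3(G).
Proof.
case: xy_rel => -> _ n_gt0; apply: groupX.
exact: subsetP (lcn_sub_leq _ _) _ s_lcn.
Qed.

(** In the second power relation the factor for l = 2 lies in gamma_3 because p divides C(p, 2), and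
    the later ones because s_l does; the right-hand side lies there if m >= 4 or z = 0. *)
Lemma y_exp_lcn3 : (0 < n) || (z == 0) -> y ^+ p \in 'L_3(G).
Proof.
case: xy_rel => _ eqy nz; have: s ^+ z \in 'L_3(G).
  case/orP: nz => [n_gt0 | /eqP->]; last exact: group1.
  by rewrite groupX // (subsetP (lcn_sub_leq _ _) _ s_lcn).
rewrite -[_ ^+ z]eqy groupMr // big_nat_cond group_prod // => l.
rewrite andbT => /andP[l_ge2 _]; case: l l_ge2 => [|[|[|l]]] // _.
  by rewrite lcn2_exp_bin2 ?scomm_lcn2.
by rewrite groupX // (subsetP (lcn_sub_leq _ _) _ (scomm_lcn defG l.+1)).
Qed.

(** * The maximal subgroups and the values of the transfers *)

Let defGyx : <<[set y; x]>> = G. Proof. by rewrite setUC. Qed.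

Let M1 := <<y |: 'L_2(G)>>%G.
(** [Mi j] is M_{j+2}. The facts on maximal subgroups are applied with (a, b) = (y, x) for M_1 and
    (x y^j, y) for [Mi j]. *)
Let Mi j := <<(x * y ^+ j)%g |: 'L_2(G)>>%G.
Let V M := transfer_morphism G (abelianization_abelian M).

Let defGi j : <<[set x * y ^+ j; y]>> = G.
Proof.
apply/eqP; rewrite eqEsubset gen_subG subUset !sub1set groupM ?groupX //=.
rewrite Gy -{1}defG gen_subG subUset !sub1set -{1}(mulgK (y ^+ j) x).
by rewrite groupM ?groupV ?groupX ?mem_gen ?set21 ?set22.
Qed.

Let nM1 : M1 <| G. Proof. exact: gen_lcn2_normal defGyx. Qed.
Let M1x : x \in G :\: M1. Proof. exact: notin_gen_lcn2 nilG nabG defGyx. Qed.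
Let iM1 : #|G : M1| = p.
Proof. exact: index_gen_lcn2 p_pr nilG nabG defGyx x_exp_lcn2. Qed.
Let M1y : y \in M1. Proof. by rewrite mem_gen ?setU11. Qed.

Let nMi j : Mi j <| G. Proof. exact: gen_lcn2_normal (defGi j). Qed.
Let Miy j : y \in G :\: Mi j.
Proof. exact: notin_gen_lcn2 nilG nabG (defGi j). Qed.
Let iMi j : #|G : Mi j| = p.
Proof. exact: index_gen_lcn2 p_pr nilG nabG (defGi j) y_exp_lcn2. Qed.
Let Mixy j : x * y ^+ j \in Mi j. Proof. by rewrite mem_gen ?setU11. Qed.

Lemma M1_sub_chi2 : M1 \subset chi2 G.
Proof. by rewrite gen_subG subUset sub1set Cy lcn2_sub_chi2. Qed.

(** M_1 is maximal and contained in chi_2, which is proper because it misses x. *)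
Lemma M1_eq_chi2 : 0 < n -> M1 :=: chi2 G.
Proof.
move=> n_gt0; apply/esym; apply: (@prime_index_eq _ G _ (chi2_group G)).
- by rewrite iM1.
- exact: M1_sub_chi2.
- exact: chi2_sub.
apply: contraTneq Gx => /= <-; case: xy_gen => _ Cx _.
by apply: Cx; rewrite !ltnS.
Qed.

Lemma lcn2_M1 : [~: chi2 G, 'L_2(G)] = 1 -> 'L_2(M1) = 1.
Proof.
move=> C1; apply/trivgP; rewrite -C1.
by apply: subset_trans (lcn2_gen_lcn2 defGyx) (commSg _ M1_sub_chi2).
Qed.

Lemma transfer_M1_x : V M1 x = ab_class M1 (s ^+ w).
Proof. by rewrite (transfer_out nM1 iM1 p_pr M1x); case: xy_rel => ->. Qed.

Lemma transfer_M1_y : V M1 y = ab_class M1 (s ^+ z).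
Proof.
rewrite (transfer_in_binomial nM1 iM1 p_pr M1y M1x).
have M1s l : scomm x y l \in M1.
  exact: (subsetP (joing_subr _ _)) (scomm_lcn2 l).
case: xy_rel => _ <-; rewrite ab_classM ?groupX ?group_prod //; last first.
  by move=> l _; rewrite groupX.
(* The range 2..p of the relation is shifted to 1..p-1 to match the binomial sum, where D^l y =
   s_{l+1} for l >= 1; the term l = 0 is y^p. *)
rewrite ab_class_prod => [|l]; last by rewrite groupX.
rewrite big_add1 /= ab_classX //.
rewrite -(big_mkord xpredT
  (fun l => ab_class M1 (iter l (fun u => [~ u, x]) y) *+ 'C(p, l.+1))%R).
rewrite big_ltn ?prime_gt0 // bin1; congr (_ + _)%R.
rewrite big_nat_cond [RHS]big_nat_cond; apply: eq_bigr => -[|l] // _.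
by rewrite ab_classX // /scomm !subSS subn0 iterSr.
Qed.

Lemma lcn2_Mi j : 'L_2(Mi j) = 'L_3(G).
Proof. exact: lcn3_gen_lcn2 nilG (defGi j) Cy. Qed.

Lemma transfer_Mi_y j : V (Mi j) y = ab_class (Mi j) (y ^+ p).
Proof. by rewrite (transfer_out (nMi j) (iMi j) p_pr (Miy j)). Qed.

Lemma transfer_Mi_xy j :
  V (Mi j) (x * y ^+ j) = ab_class (Mi j) ((x * y ^+ j) ^+ p).
Proof.
rewrite (transfer_in_binomial (nMi j) (iMi j) p_pr (Mixy j) (Miy j)).
have sLM : 'L_2(G) \subset Mi j by apply: joing_subr.
set t := x * y ^+ j; have Gt : t \in G by rewrite groupM ?groupX.
have Lt l : iter l.+1 (fun u => [~ u, y]) t \in 'L_l.+2(G).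
  by elim: l => [|l IHl]; apply: mem_commg.
rewrite -(big_mkord xpredT
  (fun l => ab_class (Mi j) (iter l (fun u => [~ u, y]) t) *+ 'C(p, l.+1))%R).
rewrite big_ltn ?prime_gt0 // bin1 -ab_classX ?Mixy //= big_nat_cond big1.
  by rewrite GRing.addr0.
move=> [|l] //; rewrite andbT => _.
have L2t := subsetP (lcn_sub_leq G (isT : 2 <= l.+2)) _ (Lt l).
have Mt := subsetP sLM _ L2t.
rewrite -ab_classX //; apply/eqP; rewrite ab_class_eq0; last exact: groupX.
rewrite lcn2_Mi.
(* The first correction term [t, y]^C(p, 2) needs the divisibility of C(p, 2) by p; the iterated
   commutators after it already lie in gamma_3. *)
case: l Lt L2t Mt => [|l] Lt L2t Mt; first exact: lcn2_exp_bin2.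
by rewrite groupX // (subsetP (lcn_sub_leq G (isT : 3 <= l.+3))).
Qed.

(** * The kernels of the transfers *)

Lemma ker_transfer_M1_total : s ^+ w \in 'L_2(M1) -> s ^+ z \in 'L_2(M1) ->
  ker_transfer G M1 = G / 'L_2(G).
Proof.
move=> Lw Lz; apply: (ker_transfer_total defG).
  rewrite transfer_M1_x; apply/eqP; rewrite ab_class_eq0 //.
  by rewrite (subsetP (lcn_sub 2 M1)).
rewrite transfer_M1_y; apply/eqP; rewrite ab_class_eq0 //.
by rewrite (subsetP (lcn_sub 2 M1)).
Qed.

Let sM1 e : s ^+ e \in M1.
Proof. by rewrite groupX // (subsetP (joing_subr _ _)) // scomm_lcn2. Qed.

Lemma ker_transfer_M1_M1 : [~: chi2 G, 'L_2(G)] = 1 -> w = 1%N -> z = 0 ->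
  ker_transfer G M1 = M1 / 'L_2(G).
Proof.
move=> /lcn2_M1 C1 w1 z0; apply: (@ker_transfer_maximal _ _ _ y x) => //.
- by rewrite [#|_ : _|]iM1.
- by rewrite [LHS]transfer_M1_y z0 ab_class1.
rewrite [X in X != _]transfer_M1_x w1 ab_class_eq0 // C1 inE.
exact: scomm_last_neq1.
Qed.

(** [Mi 0] is M_2, generated by x y^0 = x and gamma_2. As w = 0, x is killed, while y goes to
    s_{m-1}^z, nontrivial for 0 < z < p. *)
Lemma ker_transfer_M1_M2 : [~: chi2 G, 'L_2(G)] = 1 -> w = 0 -> 0 < z < p ->
  ker_transfer G M1 = Mi 0 / 'L_2(G).
Proof.
move=> /lcn2_M1 C1 w0 /andP[z_gt0 lt_zp].
apply: (@ker_transfer_maximal _ _ _ (x * y ^+ 0) y) => //.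
- by rewrite [#|_ : _|]iMi.
- by rewrite mulg1.
- by rewrite [LHS](_ : _ = V M1 x) ?mulg1 // transfer_M1_x w0 ab_class1.
rewrite [X in X != _]transfer_M1_y ab_class_eq0 // C1 inE.
by apply: contraTneq z_gt0 => /expg_scomm_last_eq1->.
Qed.

Lemma ker_transfer_Mi_total j : y ^+ p \in 'L_3(G) -> x ^+ p \in 'L_3(G) ->
  ker_transfer G (Mi j) = G / 'L_2(G).
Proof.
move=> Ly Lx; have sLM : 'L_3(G) \subset Mi j by rewrite -(lcn2_Mi j) lcn_sub.
have Lxy : (x * y ^+ j) ^+ p \in 'L_3(G).
  rewrite expgM_lcn3 //; first exact: groupX.
  by rewrite -expgM mulnC expgM groupX.
apply: (ker_transfer_total (defGi j)); apply/eqP.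
  by rewrite [X in X == _]transfer_Mi_xy ab_class_eq0 ?lcn2_Mi // (subsetP sLM).
by rewrite [X in X == _]transfer_Mi_y ab_class_eq0 ?lcn2_Mi // (subsetP sLM).
Qed.

(** By [x_exp_lcn3] this concerns only m = 3. The transfer kills y, and x y^j has the same p-th
    power as x modulo gamma_3 up to triviality, so it is not killed. *)
Lemma ker_transfer_Mi_M1 j : y ^+ p \in 'L_3(G) -> x ^+ p \notin 'L_3(G) ->
  ker_transfer G (Mi j) = M1 / 'L_2(G).
Proof.
move=> Ly Lx; have sLM : 'L_3(G) \subset Mi j by rewrite -(lcn2_Mi j) lcn_sub.
apply: (@ker_transfer_maximal _ _ _ y (x * y ^+ j)) => //.
- by rewrite [#|_ : _|]iM1.
- by rewrite groupM ?groupX.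
- apply/eqP; rewrite [X in X == _]transfer_Mi_y ab_class_eq0 ?lcn2_Mi //.
  exact: (subsetP sLM).
rewrite [X in X != _]transfer_Mi_xy ab_class_eq0; last exact: groupX.
rewrite lcn2_Mi expgM_lcn3 //; first exact: groupX.
by rewrite -expgM mulnC expgM groupX.
Qed.

(** The guard [0 < n] is there because for m = 3 chi_2 is the whole group, and the property is then
    meant for all elements. *)
Definition exp_outside_chi2 (hT : finGroupType) (H : {group hT}) : Prop :=
  forall h, h \in H -> (0 < n -> h \notin chi2 H) -> h ^+ p = 1.

Lemma ker_transfer_M1_exp : exp_outside_chi2 G ->
  ker_transfer G M1 = G / 'L_2(G).
Proof.
move=> Gp; have [_ M1'x] := setDP M1x.
have Gxy : x * y \in G by rewrite groupM.
have M1'xy : x * y \notin M1 by rewrite groupMr.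
have VM1 g : g \in G -> g \notin M1 -> V M1 g = 0%R.
  move=> Gg M1'g; rewrite (transfer_out nM1 iM1 p_pr) ?inE ?M1'g //.
  by rewrite Gp ?ab_class1 // => /M1_eq_chi2 <-.
(* The generators x and x y both lie outside M_1; y^p is not controlled for m >= 4. *)
apply: (@ker_transfer_total _ _ _ x (x * y)); try exact: VM1.
apply/eqP; rewrite eqEsubset gen_subG subUset !sub1set Gx Gxy -{1}defG.
rewrite gen_subG subUset !sub1set -{2}(mulKg x y).
by rewrite groupM ?groupV ?mem_gen ?set21 ?set22.
Qed.

Lemma ker_transfer_Mi_exp j : exp_outside_chi2 G ->
  ker_transfer G (Mi j) = G / 'L_2(G).
Proof.
move=> Gp; case: (posnP n) => [n0 | n_gt0]; last first.
  by apply: ker_transfer_Mi_total; rewrite ?y_exp_lcn3 ?x_exp_lcn3 ?n_gt0.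
by apply: ker_transfer_Mi_total; rewrite Gp ?group1 // n0.
Qed.

(** For m = 3, gamma_3 is trivial and the elements with trivial p-th power form a group containing x
    and y. For m >= 4 the transfer to M_1 kills x and y, hence everything; outside M_1 its value is
    the p-th power, and M_1' = 1. *)
Lemma exp_outside_chi2_G0 : [~: chi2 G, 'L_2(G)] = 1 -> w = 0 -> z = 0 ->
  exp_outside_chi2 G.
Proof.
move=> C1 w0 z0 h Gh; have s1 e : e = 0 -> s ^+ e = 1 by move->.
case: (posnP n) => [n0 _ | n_gt0 /(_ isT)].
  have L31 : 'L_3(G) = 1 by move: Lm1; rewrite n0.
  have gE : group_set [set g in G | g ^+ p \in 'L_3(G)].
    apply/group_setP; split=> [|a b /setIdP[Ga La] /setIdP[Gb Lb]].
      by apply/setIdP; rewrite expg1n !group1.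
    by apply/setIdP; rewrite expgM_lcn3 // groupM.
  suff sGE: G \subset Group gE.
    by move/(subsetP sGE)/setIdP: Gh => [_]; rewrite L31 => /set1P.
  rewrite -{1}defG gen_subG subUset !sub1set !inE Gx Gy /=.
  rewrite y_exp_lcn3 ?z0 ?orbT //; case: xy_rel => -> _.
  by rewrite [_ ^+ w]s1 ?group1.
rewrite -M1_eq_chi2 // => M1'h; have GDh : h \in G :\: M1 by rewrite inE M1'h.
(* Membership in M_1 is needed to read a zero class as h^p in M_1'. *)
have Mhp : h ^+ p \in M1.
  have nMh : h \in 'N(M1) := subsetP (normal_norm nM1) h Gh.
  apply: coset_idr; rewrite ?groupX // morphX //= -iM1 -card_quotient //.
    by rewrite expg_cardG ?mem_quotient.
  exact: normal_norm.
have sG : G \subset 'ker (V M1).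
  rewrite -{1}defG gen_subG subUset !sub1set; apply/andP.
  by split; apply/kerP=> //; rewrite ?transfer_M1_x ?transfer_M1_y s1 ?ab_class1.
have := mker (subsetP sG h Gh).
rewrite [X in X = _](transfer_out nM1 iM1 p_pr GDh).
by move/eqP; rewrite ab_class_eq0 // lcn2_M1 // => /set1P.
Qed.

(** A subgroup containing gamma_2 is recovered from its quotient, so [c] separates the two. Such
    inequalities are needed because [kappa] returns the first index that fits. *)
Lemma quotient_lcn2_neq (A B : {group gT}) c :
    'L_2(G) \subset A -> c \in B -> c \in G -> c \notin A ->
  B / 'L_2(G) != A / 'L_2(G).
Proof.
move=> sLA Bc Gc; apply: contraNneq => eqBA.
have nLc : c \in 'N('L_2(G)) := subsetP (lcn_norm 2 G) c Gc.
have := mem_quotient 'L_2(G) Bc; rewrite eqBA => /morphimP[d nLd Ad /= eqcd].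
have /rcosetP[u Lu ->] : c \in 'L_2(G) :* d.
  by rewrite -(val_coset nLd) -eqcd (val_coset nLc) rcoset_refl.
by rewrite groupMr // (subsetP sLA).
Qed.

Let sL2 a : 'L_2(G) \subset <<a |: 'L_2(G)>>. Proof. exact: joing_subr. Qed.

Lemma quotient_M1_neq : G / 'L_2(G) != M1 / 'L_2(G).
Proof.
by case/setDP: M1x => Gx' M1'x; apply: quotient_lcn2_neq (sL2 _) Gx _ _.
Qed.

Lemma quotient_Mi_neq j : G / 'L_2(G) != Mi j / 'L_2(G).
Proof.
by case/setDP: (Miy j) => Gy' M'y; apply: quotient_lcn2_neq (sL2 _) Gy _ _.
Qed.

Lemma quotient_Mi_M1_neq j : M1 / 'L_2(G) != Mi j / 'L_2(G).
Proof.
by case/setDP: (Miy j) => Gy' M'y; apply: quotient_lcn2_neq (sL2 _) M1y _ _.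
Qed.

End MaximalClass.

(** An injective morphism carries gamma_2 and gamma_4 to those of the image. This direction carries
    elements outside chi_2(G) to elements outside chi_2(H). *)
Lemma isog_chi2 (gT hT : finGroupType) (G : {group gT}) (H : {group hT})
    (f : {morphism G >-> hT}) g :
  'injm f -> f @* G = H -> g \in G -> f g \in chi2 H -> g \in chi2 G.
Proof.
move=> injf defH Gg; rewrite !inE Gg => /andP[_ /forall_inP Cfg].
apply/forall_inP=> u Lu; have Gu := subsetP (lcn_sub 2 G) u Lu.
have: f [~ g, u] \in f @* 'L_4(G).
  rewrite morphim_lcn // defH morphR // Cfg // -defH -morphim_lcn //.
  exact: mem_morphim.
case/morphimP=> v Gv Lv /(injmP injf) eqv; rewrite eqv //.
exact: groupR.
Qed.

Lemma isog_G0_exp (gT : finGroupType) (G : {group gT}) (p n : nat) :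
    prime p -> odd p -> isog_G0 p n.+3 0 0 G ->
  exp_outside_chi2 p n G.
Proof.
move=> p_pr p_odd [hT [H [u [v [[H_mc uv_gen C1 _ uv_rel] isoGH]]]]].
have [oH cH _] := H_mc.
have nilH : nilpotent H.
  by apply: (@pgroup_nil _ p); rewrite /pgroup oH pnatX pnat_id.
have {}C1 : [~: chi2 H, 'L_2(H)] = 1.
  by rewrite C1; apply/(lcn_nil_classP n.+2 nilH); rewrite cH.
have Hp := exp_outside_chi2_G0 p_pr p_odd H_mc uv_gen uv_rel C1 erefl erefl.
have [f injf defH] := isogP isoGH => g Gg Cg.
have Gf : f g \in H by rewrite -defH mem_morphim.
apply: (injm1 injf); first exact: groupX.
rewrite morphX // Hp // => n_gt0; apply: contra (Cg n_gt0).
exact: isog_chi2 injf defH Gg.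
Qed.

(** * Transfer types *)

Section Kappa.

Variables (gT : finGroupType) (p : nat) (G : {group gT}) (x y : gT).

Let M := maxsub G x y.

Lemma kappa_total i : ker_transfer G (M i) = G / 'L_2(G) -> kappa p G x y i = 0.
Proof. by move=> keri; rewrite /kappa /= [ker_transfer _ _]keri eqxx. Qed.

Lemma kappa_eq1 i : ker_transfer G (M i) = M 1 / 'L_2(G) ->
  G / 'L_2(G) != M 1 / 'L_2(G) -> kappa p G x y i = 1%N.
Proof.
move=> keri neq; rewrite /kappa /= [ker_transfer _ _]keri eq_sym (negPf neq).
by rewrite eqxx.
Qed.

(** The two inequalities exclude the earlier candidates 0 and 1, and [0 < p] makes the searched list
    reach 2. *)
Lemma kappa_eq2 i : 0 < p -> ker_transfer G (M i) = M 2 / 'L_2(G) ->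
    G / 'L_2(G) != M 2 / 'L_2(G) -> M 1 / 'L_2(G) != M 2 / 'L_2(G) ->
  kappa p G x y i = 2.
Proof.
case: p => // q _ keri neq neq1; rewrite /kappa /= [ker_transfer _ _]keri.
by rewrite eq_sym (negPf neq) eq_sym (negPf neq1) eqxx.
Qed.

Lemma multiplet_cons c d : kappa p G x y 1 = c ->
    (forall i, 2 <= i <= p.+1 -> kappa p G x y i = d) ->
  multiplet p G x y = c :: nseq p d.
Proof.
move=> kap1 kapi; rewrite /multiplet /= kap1; congr (_ :: _).
suff /all_pred1P: all (pred1 d) [seq kappa p G x y i | i <- iota 2 p].
  by rewrite size_map size_iota.
by apply/allP=> _ /mapP[i ipi ->]; apply/eqP/kapi; rewrite mem_iota in ipi.
Qed.

Lemma nb_total_transfers_cons (c : bool) :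
    (forall i, 2 <= i <= p.+1 ->
       (ker_transfer G (M i) == G / 'L_2(G)) = c) ->
  nb_total_transfers p G x y
    = ((ker_transfer G (M 1%N) == G / 'L_2(G)) + (if c then p else 0))%N.
Proof.
move=> kerc; rewrite /nb_total_transfers /=; congr (_ + _)%N.
have /eq_in_count-> : {in iota 2 p, (fun i =>
    ker_transfer G (M i) == G / 'L_2(G)) =1 fun=> c}.
  by move=> i; rewrite mem_iota => /kerc.
by case: c {kerc}; rewrite ?count_predT ?count_pred0 ?size_iota.
Qed.

End Kappa.

Theorem theorem2p5 (gT : finGroupType) (G : {group gT}) (x y : gT)
    (p m k z w : nat)
    (p_pr : prime p) (p_odd : odd p) (m_ge3 : 3 <= m)
    (G_mc : metabelian_maxclass p m G)
    (k_def : [~: chi2 G, 'L_2(G)] = 'L_(m - k)(G))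
    (xy_gen : selected_generators m G x y)
    (z_lt : z < p) (w_lt : w < p)
    (xy_rel : power_relations p m z w x y)
    (y_ord : m = 3 -> isog_G0 p 3 0 1 G -> #[y] = p) :
  let M := maxsub G x y in
  let KerV i := ker_transfer G (M i) in
  let kap := kappa p G x y in
  let kaps := multiplet p G x y in
  let nu := nb_total_transfers p G x y in
  (4 <= m -> M 1%N = chi2 G :> {set gT})
  (* (1) *)
  /\ ([/\ [/\ [~: chi2 G, 'L_2(G)] = 1, k = 0, 3 <= m, w = 0 & z = 0] ->
            KerV 1%N = G / 'L_2(G),
          [/\ [~: chi2 G, 'L_2(G)] = 1, k = 0, 3 <= m, w = 1%N & z = 0] ->
            KerV 1%N = M 1%N / 'L_2(G),
          [/\ [~: chi2 G, 'L_2(G)] = 1, k = 0, 4 <= m, w = 0 & 0 < z] ->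
            KerV 1%N = M 2 / 'L_2(G),
          [/\ [~: chi2 G, 'L_2(G)] = 'L_m.-1(G), k = 1%N, 5 <= m & 3 <= p] ->
            KerV 1%N = G / 'L_2(G)
        & [/\ [~: chi2 G, 'L_2(G)] = 'L_(m - k)(G), 2 <= k, 6 <= m & 5 <= p] ->
            KerV 1%N = G / 'L_2(G)]
      /\ (forall i, 2 <= i <= p.+1 ->
          [/\ [/\ m = 3, w = 1%N & z = 0] -> KerV i = M 1%N / 'L_2(G),
              [/\ m = 3, w = 0 & z = 0] -> KerV i = G / 'L_2(G)
            & 4 <= m -> KerV i = G / 'L_2(G)]))
  (* (2) *)
  /\ ([/\ 3 <= m -> isog_G0 p m 0 0 G -> kap 1%N = 0,
          3 <= m -> is_G0 p m 0 1 G x y -> kap 1%N = 1%N,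
          4 <= m -> is_G0 p m z 0 G x y -> 0 < z -> kap 1%N = 2
        & [/\ [~: chi2 G, 'L_2(G)] <> 1, 1 <= k & 5 <= m] -> kap 1%N = 0]
      /\ (forall i, 2 <= i <= p.+1 ->
          [/\ m = 3 -> is_G0 p 3 0 1 G x y -> kap i = 1%N,
              m = 3 -> isog_G0 p 3 0 0 G -> kap i = 0
            & 4 <= m -> kap i = 0]))
  (* (3) *)
  /\ [/\ m = 3 -> is_G0 p 3 0 1 G x y -> kaps = nseq p.+1 1%N /\ nu = 0,
         3 <= m -> isog_G0 p m 0 0 G -> kaps = nseq p.+1 0 /\ nu = p.+1,
         4 <= m -> is_G0 p m 0 1 G x y -> kaps = 1%N :: nseq p 0 /\ nu = p,
         4 <= m -> is_G0 p m z 0 G x y -> 0 < z ->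
           kaps = 2 :: nseq p 0 /\ nu = p
       & [/\ [~: chi2 G, 'L_2(G)] <> 1, 1 <= k & 5 <= m] ->
           kaps = nseq p.+1 0 /\ nu = p.+1].

Proof.
move=> M KerV kap kaps nu; rewrite {}/KerV {}/kap {}/kaps {}/nu.
case: m m_ge3 G_mc k_def xy_gen xy_rel y_ord => [|[|[|n]]] // _.
move=> {}G_mc {}k_def {}xy_gen {}xy_rel _.
have [_ classG _] := G_mc; have [defG Cx Cy] := xy_gen.
have p_gt0 := prime_gt0 p_pr.
have nilG : nilpotent G.
  apply: (@pgroup_nil _ p); case: G_mc => oG _ _.
  by rewrite /pgroup oG pnatX pnat_id.
have Lm1 : 'L_n.+3(G) = 1 by apply/(lcn_nil_classP n.+2 nilG); rewrite classG.
have M1E : M 1%N = <<y |: 'L_2(G)>>%G by [].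
have MiE i : 2 <= i -> M i = <<(x * y ^+ (i - 2))%g |: 'L_2(G)>>%G.
  by case: i => [|[|i]].
have M1C : 0 < n -> M 1%N = chi2 G :> {set gT}.
  exact: M1_eq_chi2 p_pr G_mc xy_gen xy_rel.
have neqG1 := quotient_M1_neq p_pr G_mc xy_gen; rewrite -M1E in neqG1.
have neqG2 := quotient_Mi_neq p_pr G_mc xy_gen 0; rewrite -(MiE 2) // in neqG2.
have neq12 := quotient_Mi_M1_neq p_pr G_mc xy_gen 0.
rewrite -(MiE 2) // -M1E in neq12.
(* For k >= 1: chi_2 = M_1, so [chi_2, gamma_2] lies in M_1', which then contains s_{m-1}. *)
have Ker1k : 0 < n -> 'L_n.+2(G) \subset [~: chi2 G, 'L_2(G)] ->
    ker_transfer G (M 1%N) = G / 'L_2(G).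
  move=> n_gt0 sLC; have sLM : 'L_n.+2(G) \subset 'L_2(M 1%N).
    apply: subset_trans sLC _; rewrite -M1C //; apply: commgS.
    exact: joing_subr.
  have Ls := subsetP sLM _ (scomm_lcn defG n).
  by apply: (ker_transfer_M1_total p_pr G_mc xy_gen xy_rel); apply: groupX.
have Ker1_00 : [~: chi2 G, 'L_2(G)] = 1 -> w = 0 -> z = 0 ->
    ker_transfer G (M 1%N) = G / 'L_2(G).
  move=> C1 w0 z0; apply: (ker_transfer_M1_total p_pr G_mc xy_gen xy_rel).
    by rewrite w0 group1.
  by rewrite z0 group1.
have Ker1_10 := ker_transfer_M1_M1 p_pr G_mc xy_gen xy_rel.
have Ker1_02 : [~: chi2 G, 'L_2(G)] = 1 -> w = 0 -> 0 < z ->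
    ker_transfer G (M 1%N) = M 2 / 'L_2(G).
  move=> C1 w0 z_gt0; apply: (ker_transfer_M1_M2 p_pr G_mc xy_gen xy_rel) => //.
  by rewrite z_gt0.
have Keri i : 2 <= i -> (0 < n) || ((w == 0) && (z == 0)) ->
    ker_transfer G (M i) = G / 'L_2(G).
  move=> /MiE-> nwz.
  apply: (ker_transfer_Mi_total p_pr p_odd G_mc xy_gen xy_rel).
    apply: (y_exp_lcn3 p_pr p_odd G_mc xy_gen xy_rel).
    by case/orP: nwz => [->|/andP[_ ->]] //; rewrite orbT.
  case/orP: nwz => [n_gt0|/andP[/eqP w0 _]].
    exact: x_exp_lcn3 xy_gen xy_rel n_gt0.
  by case: xy_rel => -> _; rewrite w0 group1.
have Keri_1 i : 2 <= i -> n = 0 -> w = 1%N -> z = 0 ->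
    ker_transfer G (M i) = M 1%N / 'L_2(G).
  move=> /MiE-> n0 w1 z0.
  apply: (ker_transfer_Mi_M1 p_pr p_odd G_mc xy_gen xy_rel).
    by apply: (y_exp_lcn3 p_pr p_odd G_mc xy_gen xy_rel); rewrite z0 orbT.
  (* For m = 3, gamma_3 = gamma_m is trivial, while x^p = s_{m-1} is not. *)
  rewrite -[3]/(0.+3) -{1}n0 Lm1 inE; case: xy_rel => -> _; rewrite w1.
  exact: scomm_last_neq1 G_mc xy_gen.
have isogKer1 : isog_G0 p n.+3 0 0 G -> ker_transfer G (M 1%N) = G / 'L_2(G).
  move/(isog_G0_exp p_pr p_odd).
  exact: ker_transfer_M1_exp p_pr G_mc xy_gen xy_rel.
have isogKeri i : 2 <= i -> isog_G0 p n.+3 0 0 G ->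
    ker_transfer G (M i) = G / 'L_2(G).
  move=> /MiE-> /(isog_G0_exp p_pr p_odd).
  exact: ker_transfer_Mi_exp p_pr p_odd G_mc xy_gen xy_rel _.
have rel_inj a b : a < p -> b < p ->
    scomm x y n.+2 ^+ a = scomm x y n.+2 ^+ b -> a = b.
  wlog le_ab : a b / a <= b.
    case: (leqP a b) => [|/ltnW] le_ab inj ap bp => [|/esym]; first exact: inj.
    by move/inj->.
  move=> _ bp; rewrite -{1}(subnK le_ab) expgD => /esym/eqP.
  rewrite eq_mulgV1 mulgK => /eqP/(expg_scomm_last_eq1 p_pr G_mc xy_gen) ab0.
  apply/eqP; rewrite eqn_leq le_ab -subn_eq0 ab0 //.
  exact: leq_ltn_trans (leq_subr _ _) bp.
(* [is_G0] refers to the same x and y, so its exponents must agree with the given z and w. *)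
have rel_uniq a b : a < p -> b < p -> power_relations p n.+3 a b x y ->
    z = a /\ w = b.
  move=> ap bp [xb ya]; case: xy_rel => xw yz; split; apply: rel_inj => //.
    by rewrite -[LHS]yz ya.
  by rewrite -[LHS]xw xb.
have G0E a b : a < p -> b < p -> is_G0 p n.+3 a b G x y ->
    [/\ [~: chi2 G, 'L_2(G)] = 1, z = a & w = b].
  by move=> ap bp [_ _ C1 _ /(rel_uniq _ _ ap bp)[-> ->]]; rewrite C1 Lm1.
have n_eq0 : n.+3 = 3 -> n = 0 by case.
(* For k >= 1, gamma_{m-k} contains gamma_{m-1}. *)
have Ker1C : [~: chi2 G, 'L_2(G)] <> 1 -> 1 <= k -> 0 < n ->
    ker_transfer G (M 1%N) = G / 'L_2(G).
  move=> _ k_gt0 n_gt0; apply: Ker1k => //; rewrite k_def lcn_sub_leq //.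
  by rewrite leq_subLR -[n.+3]add1n leq_add2r.
have p1 : 1 < p by apply: prime_gt1.
have i2 i : 2 <= i <= p.+1 -> 2 <= i by case/andP.
have kap i := @kappa_total _ p G x y i.
have nuE := @nb_total_transfers_cons _ p G x y.
have kapsE := @multiplet_cons _ p G x y.
do 3?split.
- by move=> n_gt0; apply: M1C.
- split.
  + by case=> C1 _ _ w0 z0; apply: Ker1_00.
  + by case=> C1 _ _ w1 z0; apply: Ker1_10.
  + by case=> C1 _ _ w0 z_gt0; apply: Ker1_02.
  + by case=> C1 _ n_ge2 _; apply: Ker1k; [exact: ltnW n_ge2 | rewrite C1].
  + case=> C1 k_ge2 n_ge3 _; apply: Ker1k; first exact: (@leq_trans 3).
    rewrite C1 lcn_sub_leq // leq_subLR -[n.+3]add1n leq_add2r.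
    exact: ltnW.
- move=> i /i2 i_ge2; split.
  + by case=> /n_eq0 n0 w1 z0; apply: Keri_1.
  + by case=> _ w0 z0; apply: Keri; rewrite // w0 z0 orbT.
  + by move=> n_gt0; apply: Keri; rewrite // (n_gt0 : 0 < n).
- split; first split.
  + by move=> _ /isogKer1/kap.
  + move=> _ /(G0E _ _ p_gt0 p1)[C1 z0 w1]; apply: kappa_eq1 => //.
    exact: Ker1_10.
  + move=> _ G0z z_gt0; have [C1 _ w0] := G0E _ _ z_lt p_gt0 G0z.
    by apply: kappa_eq2 => //; apply: Ker1_02.
  + by case=> C1 k_gt0 n_ge2; apply: kap; apply: Ker1C => //; apply: ltnW.
  move=> i /i2 i_ge2; split.
  + move=> n3; rewrite -{1}n3 => /(G0E _ _ p_gt0 p1)[C1 z0 w1].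
    by apply: kappa_eq1 => //; apply: Keri_1 => //; apply: n_eq0.
  + by move=> n3; rewrite -{1}n3 => /(isogKeri _ i_ge2)/kap.
  + by move=> n_gt0; apply: kap; apply: Keri; rewrite // (n_gt0 : 0 < n).
(* In all remaining cases but the first, the transfers with i >= 2 are total, and only the first
   entry varies. *)
have total_i c : kappa p G x y 1 = c ->
    (forall i, 2 <= i -> ker_transfer G (M i) = G / 'L_2(G)) ->
    multiplet p G x y = c :: nseq p 0
    /\ nb_total_transfers p G x y
       = ((ker_transfer G (M 1%N) == G / 'L_2(G)) + p)%N.
  move=> kap1 keri; split; first by apply: kapsE => // i /i2/keri/kap.
  by apply: (nuE true) => i /i2/keri->; rewrite eqxx.
split.
- move=> n3; rewrite -{1}n3 => /(G0E _ _ p_gt0 p1)[C1 z0 w1].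
  have ker_1 i : 2 <= i -> ker_transfer G (M i) = M 1%N / 'L_2(G).
    by move=> i_ge2; apply: Keri_1 => //; apply: n_eq0.
  split.
    apply: kapsE => [|i /i2/ker_1 keri]; apply: kappa_eq1 => //.
    exact: Ker1_10.
  rewrite (nuE false) => [|i /i2/ker_1->].
    by rewrite [ker_transfer _ _]Ker1_10 // eq_sym (negPf neqG1).
  by rewrite eq_sym (negPf neqG1).
- move=> _ G00; have ker1 := isogKer1 G00.
  have [|i i_ge2|-> ->] := total_i 0; [exact: kap | exact: isogKeri |].
  by rewrite ker1 eqxx.
- move=> n_gt0 /(G0E _ _ p_gt0 p1)[C1 z0 w1].
  have ker1 := Ker1_10 C1 w1 z0.
  have [|i i_ge2|-> ->] := total_i 1%N; first exact: kappa_eq1.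
    by apply: Keri; rewrite // (n_gt0 : 0 < n).
  by rewrite [ker_transfer _ _]ker1 eq_sym (negPf neqG1).
- move=> n_gt0 G0z z_gt0; have [C1 _ w0] := G0E _ _ z_lt p_gt0 G0z.
  have ker1 := Ker1_02 C1 w0 z_gt0.
  have [|i i_ge2|-> ->] := total_i 2; first exact: kappa_eq2.
    by apply: Keri; rewrite // (n_gt0 : 0 < n).
  by rewrite ker1 eq_sym (negPf neqG2).
case=> C1 k_gt0 n_ge2; have n_gt0 : 0 < n := ltnW n_ge2.
have ker1 := Ker1C C1 k_gt0 n_gt0.
have [|i i_ge2|-> ->] := total_i 0; first exact: kap.
  by apply: Keri; rewrite // n_gt0.
by rewrite ker1 eqxx.
Qed.
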